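(* If $\Phi \subseteq 2^E$ is an interval with vertex $e \in E$, then the reduction $\Phi \| e$ is the direct sum of $$\{F \in \Phi \| e : e \notin F\} = \{F \in \Phi : e \notin F,\ F \cup \{e\} \notin \Phi\}$$ and $$\{G \in \Phi \| e : e \in G\} = \{G \in \Phi : e \in G,\ G \setminus \{e\} \notin \Phi\}.$$
   Context: $E$ is a finite set and $2^E$ its Boolean algebra of subsets. A set $\Phi \subseteq 2^E$ is an interval if $F \subseteq G \subseteq H$ and $F,H \in \Phi$ imply $G \in \Phi$. Elements of $E$ are the vertices of $\Phi$ (a vertex need not lie in any member of $\Phi$). For $e \in E$, the star is $\mathrm{st}_\Phi e = \bigcup \{F, F \cup \{e\}\}$, the union over all $F$ with $e \notin F$ and $F, F\cup\{e\} \in \Phi$, and the reduction is $\Phi \| e = \Phi \setminus \mathrm{st}_\Phi e$. Two intervals $\Phi$ and $\Theta$ are totally unrelated if $F \not\subseteq G$ and $G \not\subseteq F$ whenever $F \in \Phi$ and $G \in \Theta$. In this case, their direct sum is the disjoint union $\Phi \oplus \Theta = \Phi \mathbin{\dot\cup} \Theta$, which is again an interval. Thus ''$\Psi$ is the direct sum of $\Phi$ and $\Theta$'' means that $\Phi,\Theta$ are totally unrelated intervals whose (disjoint) union is $\Psi$. *)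

(* Defs.v *)
From mathcomp Require Import all_boot.
Set Implicit Arguments.
Unset Strict Implicit.
Unset Printing Implicit Defensive.

Definition is_interval (E : finType) (Phi : {set {set E}}) : Prop :=
  forall F G H : {set E},
    F \subset G -> G \subset H -> F \in Phi -> H \in Phi -> G \in Phi.

Definition star (E : finType) (Phi : {set {set E}}) (e : E) : {set {set E}} :=
  \bigcup_(F : {set E} | [&& e \notin F, F \in Phi & e |: F \in Phi])
    [set F; e |: F].

Definition reduction (E : finType) (Phi : {set {set E}}) (e : E)
  : {set {set E}} := Phi :\: star Phi e.

Definition totally_unrelated (E : finType) (Phi Theta : {set {set E}}) : Prop :=
  forall F G : {set E}, F \in Phi -> G \in Theta ->
    ~~ (F \subset G) /\ ~~ (G \subset F).

(* The disjointness clause already follows from total unrelatedness. *)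
Definition is_direct_sum (E : finType) (Psi Phi Theta : {set {set E}}) : Prop :=
  [/\ is_interval Phi, is_interval Theta, totally_unrelated Phi Theta,
      [disjoint Phi & Theta] & Psi = Phi :|: Theta].

(* Main.v *)
Require Import Defs.
From mathcomp Require Import all_boot.

(** Toggling [e] pairs up the subsets of [E], and the star collects the pairs lying wholly in [Phi]
    ([mem_star]). So the reduction keeps exactly the members whose partner is missing, which gives
    both descriptions of the halves. The rest is convexity of [Phi]: any failure of the direct-sum
    conditions would squeeze a missing partner between two members of [Phi]. *)

Lemma mem_star (E : finType) (Phi : {set {set E}}) (e : E) (F : {set E}) :
  (F \in star Phi e) =
    (F \in Phi) && (if e \in F then F :\ e \in Phi else e |: F \in Phi).
Proof.
apply/bigcupP/andP => [[F0 /and3P[eF0 F0Phi eF0Phi]]|[FPhi]].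
  by rewrite !inE => /orP[]/eqP->; rewrite ?(negPf eF0) // setU11 setU1K.
case: ifPn => eF FePhi.
  (* The star indexes each pair by its lower set, here the partner of [F]. *)
  exists (F :\ e); last by rewrite !inE setD1K // eqxx orbT.
  by rewrite setD11 FePhi setD1K.
by exists F; rewrite ?eF ?FPhi // !inE eqxx.
Qed.

Lemma reduction_notinE (E : finType) (Phi : {set {set E}}) (e : E) :
  [set F in reduction Phi e | e \notin F]
    = [set F in Phi | (e \notin F) && (e |: F \notin Phi)].
Proof.
apply/setP => F; rewrite !inE mem_star.
by case: (F \in Phi); case: (e \in F); rewrite /= ?andbT ?andbF.
Qed.

Lemma reduction_inE (E : finType) (Phi : {set {set E}}) (e : E) :
  [set G in reduction Phi e | e \in G]
    = [set G in Phi | (e \in G) && (G :\ e \notin Phi)].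
Proof.
apply/setP => G; rewrite !inE mem_star.
by case: (G \in Phi); case: (e \in G); rewrite /= ?andbT ?andbF.
Qed.

Theorem proposition2p5 (E : finType) (Phi : {set {set E}}) (e : E)
    (hPhi : is_interval Phi) :
  [/\ [set F in reduction Phi e | e \notin F]
        = [set F in Phi | (e \notin F) && (e |: F \notin Phi)],
      [set G in reduction Phi e | e \in G]
        = [set G in Phi | (e \in G) && (G :\ e \notin Phi)]
    & is_direct_sum (reduction Phi e)
        [set F in reduction Phi e | e \notin F]
        [set G in reduction Phi e | e \in G]].
Proof.
split; [exact: reduction_notinE | exact: reduction_inE | split].
- rewrite reduction_notinE => F G H FG GH.
  rewrite !inE => /and3P[FPhi _ eFPhi] /and3P[HPhi eH _].
  rewrite (hPhi _ _ _ FG GH FPhi HPhi) (contra (subsetP GH e) eH) /=.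
  (* If [e |: G] were in [Phi], the missing [e |: F] would lie between [F] and [e |: G]. *)
  apply: contra eFPhi => eGPhi.
  exact: hPhi (subsetU1 e F) (setUS _ FG) FPhi eGPhi.
- rewrite reduction_inE => F G H FG GH.
  rewrite !inE => /and3P[FPhi eF _] /and3P[HPhi _ HePhi].
  rewrite (hPhi _ _ _ FG GH FPhi HPhi) (subsetP FG e eF) /=.
  (* Dually, the missing [H :\ e] would lie between [G :\ e] and [H]. *)
  apply: contra HePhi => GePhi.
  exact: hPhi (setSD _ GH) (subD1set H e) GePhi HPhi.
- rewrite reduction_notinE reduction_inE => F G.
  rewrite !inE => /and3P[FPhi eF eFPhi] /and3P[GPhi eG _].
  (* Only [F \subset G] needs convexity: as [e] is in [G], the missing [e |: F] would lie between
     [F] and [G]. *)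
  split; last by apply: contra eF => /subsetP; apply.
  apply: contra eFPhi => FG.
  by apply: hPhi (subsetU1 e F) _ FPhi GPhi; rewrite subUset sub1set eG.
- by rewrite disjoint_subset; apply/subsetP => F; rewrite !inE => /andP[_ /negPf->]; rewrite andbF.
- by apply/setP => F; rewrite !inE -andb_orr orNb andbT.
Qed.
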